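(* Let $N$ be a positive integer and $a\in\{1,2,\ldots,N\}$. For formal variables $u,w$, $$1+\sum_{k\geq 2n,\ n\geq 1}G_{0,N,a}(k,n,n)\,u^{k-2n}w^n=\exp\left\{\sum_{n=2}^\infty\frac{t_{N,a}(n)}{n}\,(u^n-x^n-y^n)\right\},$$ where $x,y$ are determined by $x+y=u$ and $xy=w$.
   Context: An index is a finite sequence $\mathbf{k}=(k_1,\ldots,k_n)$ of positive integers; its weight is $k_1+\cdots+k_n$, its depth is $n$, and its height is the number of $j$ with $k_j\geq 2$. It is admissible if $k_1>1$. For an admissible index, $$t_{N,a}(k_1,\ldots,k_n)=\sum_{m_1>\cdots>m_n>0,\ m_i\equiv a\ (\mathrm{mod}\ N)}\frac{1}{m_1^{k_1}\cdots m_n^{k_n}}.$$ $I_0(k,n,s)$ is the set of admissible indices of weight $k$, depth $n$ and height $s$, and $G_{0,N,a}(k,n,s)=\sum_{\mathbf{k}\in I_0(k,n,s)}t_{N,a}(\mathbf{k})$. The identity is one of formal power series in $u,w$; note that $x^n+y^n$ is a polynomial in $u=x+y$ and $w=xy$. *)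

(* Defs.v *)
From HB Require Import structures.
From mathcomp Require Import all_boot all_order all_algebra.
From mathcomp Require Import polyXY ring.
From mathcomp Require Import all_classical all_reals all_analysis.

Set Implicit Arguments.
Unset Strict Implicit.
Unset Printing Implicit Defensive.

Import Order.TTheory GRing.Theory Num.Theory.

Local Open Scope classical_set_scope.
Local Open Scope ring_scope.

(* An index (k_1, ..., k_n) is the list [:: k_1; ...; k_n] : seq nat. *)
Definition is_index (k : seq nat) : bool := all (leq 1) k.
Definition weight (k : seq nat) : nat := sumn k.
Definition depth (k : seq nat) : nat := size k.
Definition height (k : seq nat) : nat := count (leq 2) k.
Definition admissible (k : seq nat) : bool := is_index k && (1 < head 0 k)%N.

Definition I0 (k n s : nat) : set (seq nat) :=
  [set x | [/\ admissible x, weight x = k, depth x = n & height x = s]].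

(* The lists (m_1, ..., m_n) with m_1 > ... > m_n > 0 and m_i = a mod N. *)
Definition t_domain (N a n : nat) : set (seq nat) :=
  [set m | [/\ size m = n, sorted gtn m, all (leq 1) m
             & all (fun x => x == a %[mod N])%N m]].

(* The unordered sum of nonnegative terms is taken in \bar R; it is finite for
   admissible indices, so that [fine] returns its value there. *)
Definition t (R : realType) (N a : nat) (k : seq nat) : R :=
  fine (\esum_(m in t_domain N a (size k))
          (\prod_(p <- zip m k) (p.1%:R ^- p.2))%:E)%E.

Definition G0 (R : realType) (N a k n s : nat) : R :=
  \sum_(x \in I0 k n s) t R N a x.

(* [\sum_(_ \in _)] is 0 on families of infinite support, but I0 is finite. *)
Lemma finite_I0 (k n s : nat) : finite_set (I0 k n s).
Proof.
pose f (x : n.-tuple 'I_k.+1) : seq nat := map val x.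
apply: (@sub_finite_set _ _ (f @` setT)); last first.
  by apply: finite_image; exact: finite_finset.
move=> x [_ wx dx _].
have bx i : i \in x -> (i < k.+1)%N.
  rewrite ltnS -wx /weight => ix.
  by elim: x ix {wx dx} => //= y x IH; rewrite inE => /orP[/eqP->|/IH h];
    [exact: leq_addr|exact: leq_trans h (leq_addl _ _)].
have sz : size (map (fun i => inord i : 'I_k.+1) x) == n by rewrite size_map -dx.
exists (Tuple sz) => //; rewrite /f /= -map_comp -[RHS]map_id.
by apply/eq_in_map => i ix /=; rewrite inordK ?bx.
Qed.

(* Formal power series in u and w: [f i j] is the coefficient of u^i w^j. *)
Definition fps2 (R : Type) : Type := nat -> nat -> R.

(* A polynomial in u, w is an element of {poly {poly R}}, the inner variable
   being u and the outer one w. *)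
Definition poly_u {R : realType} : {poly {poly R}} := 'X%:P.
Definition poly_w {R : realType} : {poly {poly R}} := 'X.

Definition fps2_of_poly (R : realType) (q : {poly {poly R}}) : fps2 R :=
  fun i j => q`_j`_i.

Definition fps2_one (R : realType) : fps2 R := fps2_of_poly 1.

Definition fps2_scale (R : realType) (c : R) (f : fps2 R) : fps2 R :=
  fun i j => c * f i j.

Definition fps2_add (R : realType) (f g : fps2 R) : fps2 R :=
  fun i j => f i j + g i j.

Definition fps2_mul (R : realType) (f g : fps2 R) : fps2 R :=
  fun i j => \sum_(b < i.+1) \sum_(c < j.+1) f b c * g (i - b)%N (j - c)%N.

Definition fps2_pow (R : realType) (f : fps2 R) (m : nat) : fps2 R :=
  iter m (fps2_mul f) (fps2_one R).

(* Formal infinite sum: meaningful for families in which every monomial occurs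
   with a nonzero coefficient only finitely often. *)
Definition fps2_sum (R : realType) (I : choiceType) (A : set I)
    (f : I -> fps2 R) : fps2 R :=
  fun i j => \sum_(l \in A) f l i j.

(* Meaningful for f without constant term. *)
Definition fps2_exp (R : realType) (f : fps2 R) : fps2 R :=
  fps2_sum [set: nat] (fun m => fps2_scale (m`!%:R^-1) (fps2_pow f m)).

(* q(x + y, x y) for formal x = 'X and y = 'Y. *)
Definition subst_xy (R : realType) (q : {poly {poly R}}) : {poly {poly R}} :=
  \sum_(j < size q) \sum_(i < size q`_j)
     (q`_j`_i)%:P%:P * ('X + 'Y) ^+ i * ('X * 'Y) ^+ j.

(* q(u, w) is the expression of x^n + y^n as a polynomial in u = x + y and
   w = x y. *)
Definition expresses_power_sum (R : realType) (n : nat) (q : {poly {poly R}}) :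
    Prop :=
  subst_xy q = 'X ^+ n + 'Y ^+ n.

Lemma subst_xyE (R : realType) (q : {poly {poly R}}) :
  subst_xy q = (map_poly (fun c : {poly R} => (c ^:P) \Po ('X + 'Y)) q).['X * 'Y].
Proof.
rewrite horner_poly; apply: eq_bigr => j _.
rewrite comp_polyE size_map_polyC mulr_suml; apply: eq_bigr => i _.
by rewrite coef_map /= mul_polyC.
Qed.

Lemma power_sum_exists (R : realType) (n : nat) :
  exists q : {poly {poly R}}, expresses_power_sum n q.
Proof.
pose z : {poly {poly R}} := 'X + 'Y.
pose f : {rmorphism {poly R} -> {poly {poly R}}} :=
  GRing.RMorphism.clone _ _ (comp_poly z \o map_poly polyC) _.
pose g : {rmorphism {poly {poly R}} -> {poly {poly R}}} :=
  GRing.RMorphism.clone _ _ (horner_eval ('X * 'Y) \o map_poly f) _.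
have gE q : subst_xy q = g q by rewrite subst_xyE.
have gu : g poly_u = 'X + 'Y.
  by rewrite /g /= map_polyC /= map_polyX comp_polyX /horner_eval hornerC.
have gw : g poly_w = 'X * 'Y.
  by rewrite /g /= /poly_w map_polyX /horner_eval hornerX.
rewrite /expresses_power_sum.
suff [] : (exists q : {poly {poly R}}, subst_xy q = 'X ^+ n + 'Y ^+ n) /\
          (exists q : {poly {poly R}}, subst_xy q = 'X ^+ n.+1 + 'Y ^+ n.+1).
  by [].
elim: n => [|n [[p hp] [q hq]]].
  split; first by exists 2; rewrite gE rmorphMn rmorph1 !expr0 -mulr2n.
  by exists poly_u; rewrite gE gu !expr1.
split; first by exists q.
exists (poly_u * q - poly_w * p).
rewrite gE rmorphB 2!rmorphM gu gw -(gE q) -(gE p) hp hq.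
by rewrite !exprS; ring.
Qed.

(* Main.v *)
(* Put z_m = 1/m for m = a mod N and z_m = 0 otherwise. Truncating all sums at
   m <= M, the left-hand side is the finite product of the factors
   1 + w z^2 / (1 - u z) over z = z_m, since depth = height means that all
   entries of the index are >= 2. With the derivation D that multiplies
   u^i w^j by i + 2 j, each factor P satisfies
   D P = P * \sum_n z^n (u^n - x^n - y^n), an identity that comes down to
   Newton's recursion p_(n+2) = u p_(n+1) - w p_n for p_n = x^n + y^n. Letting
   M grow coefficientwise, both sides of the theorem satisfy
   D F = F * \sum_n t(n) (u^n - p_n), whose solution is determined by its
   constant term. *)

Require Import Defs.
From HB Require Import structures.
From mathcomp Require Import all_boot all_order all_algebra.
From mathcomp Require Import polyXY ring zify.
From mathcomp Require Import all_classical all_reals all_analysis.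

Set Implicit Arguments.
Unset Strict Implicit.
Unset Printing Implicit Defensive.

Import Order.TTheory GRing.Theory Num.Theory.
Import numFieldNormedType.Exports.

Local Open Scope classical_set_scope.
Local Open Scope ring_scope.

(** * Ring structure, derivation and exponential on series in $u,w$ *)

Section Fps2Ring.
Variable R : realType.
Implicit Types (f g h : fps2 R) (p q : {poly {poly R}}).

(** A polynomial stands in for a series on the box of exponents below [n]. Product coefficients in
    the box use only coefficients in the box, so ring laws pass from [{poly {poly R}}] to series. *)
Definition fps2_agree (n : nat) (p : {poly {poly R}}) (f : fps2 R) :=
  forall i j, (i < n)%N -> (j < n)%N -> p`_j`_i = f i j.

Definition fps2_trunc (n : nat) (f : fps2 R) : {poly {poly R}} :=
  \poly_(j < n) \poly_(i < n) f i j.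

Lemma fps2_truncP n f : fps2_agree n (fps2_trunc n f) f.
Proof. by move=> i j ltin ltjn; rewrite coef_poly ltjn coef_poly ltin. Qed.

Lemma fps2_agree_mul n p q f g :
  fps2_agree n p f -> fps2_agree n q g ->
  fps2_agree n (p * q) (fps2_mul f g).
Proof.
move=> pf qg i j ltin ltjn; rewrite coefM coef_sum /fps2_mul.
under eq_bigr => c _ do rewrite coefM.
rewrite exchange_big; apply: eq_bigr => b _; apply: eq_bigr => c _ /=.
have := ltn_ord b; have := ltn_ord c; rewrite !ltnS => lec leb.
by rewrite pf ?qg //; lia.
Qed.

Lemma fps2_agree_eq f g :
  (forall n, exists2 p, fps2_agree n p f & fps2_agree n p g) -> f = g.
Proof.
move=> fg; apply/funext => i; apply/funext => j.
have [p pf pg] := fg (maxn i j).+1.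
by rewrite -pf ?pg // ltnS ?leq_maxl ?leq_maxr.
Qed.

Lemma fps2_mulA : associative (@fps2_mul R).
Proof.
move=> f g h; apply: fps2_agree_eq => n.
exists (fps2_trunc n f * fps2_trunc n g * fps2_trunc n h); last first.
  by do 2?[apply: fps2_agree_mul]; exact: fps2_truncP.
by rewrite -mulrA; do 2?[apply: fps2_agree_mul]; exact: fps2_truncP.
Qed.

Lemma fps2_mulC : commutative (@fps2_mul R).
Proof.
move=> f g; apply: fps2_agree_eq => n.
exists (fps2_trunc n f * fps2_trunc n g); last rewrite mulrC;
  by apply: fps2_agree_mul; exact: fps2_truncP.
Qed.

Lemma fps2_mul1 : left_id (fps2_one R) (@fps2_mul R).
Proof.
move=> f; apply: fps2_agree_eq => n.
exists (1 * fps2_trunc n f); last by rewrite mul1r; exact: fps2_truncP.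
by apply: fps2_agree_mul => //; exact: fps2_truncP.
Qed.

Lemma fps2_mulDl : left_distributive (@fps2_mul R) (@fps2_add R).
Proof.
move=> f g h; apply/funext => i; apply/funext => j.
rewrite /fps2_add /fps2_mul -big_split; apply: eq_bigr => b _ /=.
by rewrite -big_split; apply: eq_bigr => c _ /=; rewrite mulrDl.
Qed.

HB.instance Definition _ := GRing.Zmodule.copy (fps2 R) (nat -> nat -> R).

Lemma fps2_one_neq0 : fps2_one R != 0 :> fps2 R.
Proof.
apply/eqP => /(congr1 (fun f : fps2 R => f 0%N 0%N)).
by rewrite /fps2_one /fps2_of_poly !coef1 => /eqP; rewrite oner_eq0.
Qed.

HB.instance Definition _ := GRing.Zmodule_isComNzRing.Build (fps2 R)
  fps2_mulA fps2_mulC fps2_mul1 fps2_mulDl fps2_one_neq0.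

Lemma fps2_powE f m : fps2_pow f m = f ^+ m.
Proof. by elim: m => // m IH; rewrite exprS -IH. Qed.

Lemma fps2_oneE i j : (1 : fps2 R) i j = ((i == 0%N) && (j == 0%N))%:R.
Proof.
rewrite -[1]/(fps2_one R) /fps2_one /fps2_of_poly coef1.
by case: j => [|j]; rewrite ?coef1 ?andbT ?coef0 ?andbF.
Qed.

Lemma fps2_addE f g i j : (f + g) i j = f i j + g i j.
Proof. by []. Qed.

Lemma fps2_mulE f g i j : (f * g) i j =
  \sum_(b < i.+1) \sum_(c < j.+1) f b c * g (i - b)%N (j - c)%N.
Proof. by []. Qed.

Lemma fps2_sumE (I : Type) (r : seq I) (P : pred I) (F : I -> fps2 R) i j :
  (\sum_(l <- r | P l) F l) i j = \sum_(l <- r | P l) F l i j.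
Proof.
by elim/big_rec2: _ => // l x y _ <-.
Qed.

(** This is $u\,\partial_u+2w\,\partial_w$; the weights 1 and 2 are the degrees of $u=x+y$ and
    $w=xy$ in $x,y$. *)
Definition fps2_deriv (f : fps2 R) : fps2 R :=
  fun i j => (i + 2 * j)%:R * f i j.

Lemma fps2_derivM f g :
  fps2_deriv (f * g) = fps2_deriv f * g + f * fps2_deriv g.
Proof.
apply/funext => i; apply/funext => j.
rewrite fps2_addE /fps2_deriv !fps2_mulE mulr_sumr -big_split /=.
apply: eq_bigr => b _; rewrite mulr_sumr -big_split /=.
apply: eq_bigr => c _; rewrite mulrA [X in _ + X]mulrCA -!mulrA.
rewrite (_ : i + 2 * j = (b + 2 * c) + ((i - b) + 2 * (j - c)))%N.
  by rewrite natrD; ring.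
by have := ltn_ord b; have := ltn_ord c; lia.
Qed.

Lemma fps2_deriv1 : fps2_deriv 1 = 0.
Proof.
apply/funext => i; apply/funext => j; rewrite /fps2_deriv fps2_oneE.
case: eqP => [->|]; last by rewrite mulr0.
by case: eqP => [->|]; rewrite ?mul0r ?mulr0.
Qed.

Lemma fps2_derivX f m :
  fps2_deriv (f ^+ m.+1) = fps2_deriv f * f ^+ m *+ m.+1.
Proof.
elim: m => [|m IH]; first by rewrite expr1 expr0 mulr1.
rewrite exprS fps2_derivM IH [in RHS]mulrS exprS.
by rewrite mulrnAr; congr (_ + _ *+ _); ring.
Qed.

(** Induction on the weight $i+2j$: a positive weight is invertible in [R], and since [h] has no
    constant term, the coefficient of [F * h] involves only coefficients of [F] of smaller
    weight. *)
Lemma fps2_deriv_uniq (F G h : fps2 R) :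
    fps2_deriv F = F * h -> fps2_deriv G = G * h ->
    h 0%N 0%N = 0 -> F 0%N 0%N = G 0%N 0%N -> F = G.
Proof.
move=> dF dG h0 FG0.
suff H n : forall i j, (i + 2 * j <= n)%N -> F i j = G i j.
  by apply/funext => i; apply/funext => j; apply: (H (i + 2 * j)%N).
elim: n => [|n IH] i j lejn; first by have [-> ->] : i = 0%N /\ j = 0%N by lia.
have [ij0|ij0] := eqVneq (i + 2 * j)%N 0%N.
  by have [-> ->] : i = 0%N /\ j = 0%N by lia.
have neq0 : (i + 2 * j)%:R != 0 :> R by rewrite pnatr_eq0.
apply: (mulfI neq0).
rewrite -[LHS]/(fps2_deriv F i j) -[RHS]/(fps2_deriv G i j) dF dG !fps2_mulE.
apply: eq_bigr => b _; apply: eq_bigr => c _.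
have := ltn_ord b; have := ltn_ord c; rewrite !ltnS => lec leb.
have [/andP[/eqP bi /eqP cj]|bc] := boolP ((i - b == 0) && (j - c == 0))%N.
  by rewrite bi cj h0 !mulr0.
congr (_ * _); apply: IH; lia.
Qed.

Lemma fps2_derivZ c f :
  fps2_deriv (fps2_scale c f) = fps2_scale c (fps2_deriv f).
Proof.
by apply/funext => i; apply/funext => j; rewrite /fps2_deriv /fps2_scale mulrCA.
Qed.

Lemma fps2_scaleAl c f g : fps2_scale c (f * g) = fps2_scale c f * g.
Proof.
apply/funext => i; apply/funext => j.
rewrite /fps2_scale !fps2_mulE mulr_sumr; apply: eq_bigr => b _.
by rewrite mulr_sumr; apply: eq_bigr => c' _; rewrite mulrA.
Qed.

Lemma fps2_mulrnE f n i j : (f *+ n) i j = f i j *+ n.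
Proof. by elim: n => // n IH; rewrite !mulrS fps2_addE IH. Qed.

Lemma fps2_scaleMn c f n : fps2_scale c (f *+ n) = fps2_scale (c *+ n) f.
Proof.
apply/funext => i; apply/funext => j.
by rewrite /fps2_scale fps2_mulrnE mulrnAr mulrnAl.
Qed.

Definition fps2_exp_trunc (K : nat) f : fps2 R :=
  \sum_(m < K) fps2_scale (m`!%:R^-1) (f ^+ m).

(** $D(f^{m+1}/(m+1)!)=(f^m/m!)\,Df$ and the term $m=0$ dies, so one term is lost. *)
Lemma fps2_deriv_exp_trunc K f :
  fps2_deriv (fps2_exp_trunc K.+1 f) = fps2_exp_trunc K f * fps2_deriv f.
Proof.
have derivE (n : nat) (F : nat -> fps2 R) :
    fps2_deriv (\sum_(m < n) F m) = \sum_(m < n) fps2_deriv (F m).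
  apply/funext => i; apply/funext => j.
  by rewrite fps2_sumE /fps2_deriv fps2_sumE mulr_sumr.
rewrite /fps2_exp_trunc (derivE _ (fun m => fps2_scale (m`!%:R^-1) (f ^+ m))).
rewrite big_ord_recl mulr_suml expr0 fps2_derivZ fps2_deriv1.
rewrite [X in X + _](_ : _ = 0) ?add0r; last first.
  by apply/funext => i; apply/funext => j; rewrite /fps2_scale mulr0.
apply: eq_bigr => m _; rewrite /= fps2_derivZ fps2_derivX fps2_scaleMn.
rewrite mulrC -fps2_scaleAl factS natrM invfM -mulrnAl -[X in X * _]mulr_natr.
by rewrite mulVf ?pnatr_eq0// mul1r.
Qed.

(** The hypothesis says that $w$ divides [f], so each factor raises the exponent of $w$. Hence the
    exponential is a finite sum in each coefficient. *)
Lemma fps2_expr_eq0 f m i j :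
  (forall i, f i 0%N = 0) -> (j < m)%N -> (f ^+ m) i j = 0.
Proof.
move=> f0; elim: m i j => // m IH i j ltjm.
rewrite exprS fps2_mulE big1 // => b _; rewrite big1 // => c _.
have [->|c0] := eqVneq (c : nat) 0%N; first by rewrite f0 mul0r.
by rewrite IH ?mulr0 //; have := ltn_ord c; lia.
Qed.

Lemma fps2_expE f K i j : (forall i, f i 0%N = 0) -> (j < K)%N ->
  fps2_exp f i j = fps2_exp_trunc K f i j.
Proof.
move=> f0 ltjK; rewrite /fps2_exp /fps2_sum /fps2_exp_trunc fps2_sumE.
rewrite (fsbig_ord _ _ (fun m => fps2_scale (m`!%:R^-1) (f ^+ m) i j)).
transitivity (\sum_(m \in setT) fps2_scale (m`!%:R^-1) (f ^+ m) i j).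
  by apply: eq_fsbigr => m _; rewrite fps2_powE.
apply/esym/fsbig_widen => // m [_ /negP]; rewrite -leqNgt => leKm /=.
by rewrite /fps2_scale fps2_expr_eq0 ?mulr0 //; exact: leq_trans leKm.
Qed.

Lemma fps2_deriv_exp f : (forall i, f i 0%N = 0) ->
  fps2_deriv (fps2_exp f) = fps2_exp f * fps2_deriv f.
Proof.
move=> f0; apply/funext => i; apply/funext => j.
(* The derivative shortens the sum by one, and length [j.+1] still covers every exponent of $w$ up
   to $j$. *)
rewrite /fps2_deriv (@fps2_expE _ j.+2) //.
rewrite -[LHS]/(fps2_deriv (fps2_exp_trunc j.+2 f) i j) fps2_deriv_exp_trunc.
rewrite !fps2_mulE; apply: eq_bigr => b _; apply: eq_bigr => c _.
by rewrite (@fps2_expE _ j.+1).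
Qed.

End Fps2Ring.

(** * Power sums $x^n+y^n$ as polynomials in $u,w$ *)

Section PowerSums.
Variable R : realType.
Implicit Types q : {poly {poly R}}.

(** Together with [subst_uw], this presents [subst_xy] as a ring morphism, computable from its
    values on [poly_u] and [poly_w]. *)
Definition subst_u : {rmorphism {poly R} -> {poly {poly R}}} :=
  GRing.RMorphism.clone _ _
    (comp_poly ('X + 'Y : {poly {poly R}}) \o map_poly polyC) _.

Definition subst_uw : {rmorphism {poly {poly R}} -> {poly {poly R}}} :=
  GRing.RMorphism.clone _ _
    (horner_eval ('X * 'Y : {poly {poly R}}) \o map_poly subst_u) _.

Lemma subst_uwE q : subst_xy q = subst_uw q.
Proof. by rewrite subst_xyE. Qed.

Lemma subst_uwC (c : {poly R}) : subst_uw c%:P = subst_u c.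
Proof. by rewrite /= map_polyC /= /horner_eval hornerC. Qed.

Lemma subst_uw_u : subst_uw poly_u = 'X + 'Y.
Proof. by rewrite subst_uwC /= map_polyX comp_polyX. Qed.

Lemma subst_uw_w : subst_uw poly_w = 'X * 'Y.
Proof. by rewrite /= /poly_w map_polyX /horner_eval hornerX. Qed.

(* Setting x = 0 in q(x + y, x y) = 0 kills the w-constant coefficient of q,
   and then a factor x y can be cancelled. *)
Lemma subst_uw_eq0 q : subst_uw q = 0 -> q = 0.
Proof.
elim/poly_ind: q => // q c IH.
rewrite rmorphD rmorphM subst_uw_w subst_uwC => qc0.
have c0 : c = 0.
  have := congr1 (fun s : {poly {poly R}} => s.[0]) qc0.
  rewrite horner0 !hornerE /= horner_comp !hornerE.
  by rewrite -[_.['X]]/(c \Po 'X) comp_polyXr.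
move: qc0; rewrite c0 rmorph0 addr0 => /eqP.
rewrite !mulf_eq0 polyX_eq0 polyC_eq0 polyX_eq0 !orbF => /eqP /IH ->.
by rewrite mul0r addr0.
Qed.

(** Algebraic independence of $x+y$ and $xy$: identities between the [p n] may be checked in
    $x,y$. *)
Lemma subst_uw_inj : injective subst_uw.
Proof.
move=> q1 q2 e; apply/eqP; rewrite -subr_eq0; apply/eqP/subst_uw_eq0.
by rewrite rmorphB e subrr.
Qed.

Variable p : nat -> {poly {poly R}}.
Hypothesis hp : forall n, expresses_power_sum n (p n).

Lemma subst_uw_power_sum n : subst_uw (p n) = 'X ^+ n + 'Y ^+ n.
Proof. by rewrite -subst_uwE hp. Qed.

Lemma power_sum0 : p 0%N = 2%:R.
Proof.
by apply: subst_uw_inj; rewrite subst_uw_power_sum rmorph_nat !expr0.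
Qed.

Lemma power_sum1 : p 1%N = poly_u.
Proof.
by apply: subst_uw_inj; rewrite subst_uw_power_sum subst_uw_u !expr1.
Qed.

Lemma power_sumSS n : p n.+2 = poly_u * p n.+1 - poly_w * p n.
Proof.
apply: subst_uw_inj; rewrite rmorphB 2!rmorphM subst_uw_u subst_uw_w.
by rewrite !subst_uw_power_sum !exprS; ring.
Qed.

Lemma coef_power_sumSS n i j : (p n.+2)`_j`_i =
  (if i is i'.+1 then (p n.+1)`_j`_i' else 0) -
  (if j is j'.+1 then (p n)`_j'`_i else 0).
Proof.
rewrite power_sumSS coefB coefB /poly_u /poly_w coefCM !coefXM.
by case: i; case: j => *; rewrite /= ?coef0.
Qed.

(** Homogeneity, with $u$ of weight 1 and $w$ of weight 2. Newton's recursion reaches back two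
    steps, so the induction carries two consecutive values. *)
Lemma coef_power_sum_neq n i j : (i + 2 * j)%N != n -> (p n)`_j`_i = 0.
Proof.
suff [] : (forall i j, (i + 2 * j)%N != n -> (p n)`_j`_i = 0) /\
          (forall i j, (i + 2 * j)%N != n.+1 -> (p n.+1)`_j`_i = 0).
  by move=> H _; exact: H.
elim: n {i j} => [|n [IH1 IH2]].
  split=> i j.
    rewrite power_sum0 -[2%:R](polyC_natr _ 2) coefC.
    by case: j => [|j]; rewrite ?coef0 // -polyC_natr coefC; case: i.
  rewrite power_sum1 /poly_u coefC; case: j => [|j]; rewrite ?coef0 // coefX.
  by rewrite muln0 addn0 => /negPf ->.
split=> // i j ij; rewrite coef_power_sumSS.
case: i j ij => [|i] [|j] ij; rewrite ?subrr // ?IH1 ?IH2 ?subrr //; lia.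
Qed.

Lemma coef_power_sum_u n : (p n.+1)`_0`_n.+1 = 1.
Proof.
elim: n => [|n IH]; last by rewrite coef_power_sumSS IH subr0.
by rewrite power_sum1 coefC coefX.
Qed.

Lemma coef_power_sum_uw i : (p (i + 2))`_1`_i = - (i + 2)%:R.
Proof.
elim: i => [|i IH].
  rewrite coef_power_sumSS power_sum0 -[2%:R](polyC_natr _ 2) coefC.
  by rewrite -polyC_natr coefC sub0r.
rewrite addn2 coef_power_sumSS -[i.+2]addn2 IH coef_power_sum_u.
by rewrite -opprD natr1 addn2.
Qed.

(** By homogeneity, the coefficient of $u^iw^j$ in $\sum_{n\ge1}(u^n-p_n)$ comes from $n=i+2j$
    alone. The truth value after [*+] removes $n=0$, where $1-p_0=-1$. *)
Definition power_defect : fps2 R :=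
  fun i j =>
    (poly_u ^+ (i + 2 * j) - p (i + 2 * j)%N)`_j`_i *+ (0 < i + 2 * j)%N.

Lemma power_defect_0 i : power_defect i 0%N = 0.
Proof.
rewrite /power_defect muln0 addn0; case: i => // i.
by rewrite !coefB coef_power_sum_u /poly_u -polyC_exp coefC coefXn eqxx subrr.
Qed.

Lemma power_defectS i j :
  power_defect i j.+1 = - (p (i + 2 * j.+1)%N)`_j.+1`_i.
Proof.
rewrite /power_defect (_ : 0 < i + 2 * j.+1)%N; last by lia.
by rewrite !coefB /poly_u -polyC_exp coefC coef0 sub0r.
Qed.

Lemma power_defect1 i : power_defect i 1%N = (i + 2)%:R.
Proof. by rewrite power_defectS muln1 coef_power_sum_uw opprK. Qed.

(** Newton's recursion unrolled in [i]: row $j+2$, as a series in $u$, is row $j+1$ times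
    $-1/(1-u)$, and dividing by $1-u$ takes partial sums. *)
Lemma power_defectSS i j :
  power_defect i j.+2 = - \sum_(b < i.+1) power_defect b j.+1.
Proof.
elim: i => [|i IH].
  rewrite big_ord1 !power_defectS.
  rewrite (_ : 0 + 2 * j.+2 = (2 * j.+1).+2)%N; last by lia.
  by rewrite coef_power_sumSS sub0r.
rewrite big_ord_recr /= opprD -IH !power_defectS.
rewrite (_ : i.+1 + 2 * j.+2 = (i.+1 + 2 * j.+1).+2)%N; last by lia.
rewrite coef_power_sumSS.
rewrite (_ : (i.+1 + 2 * j.+1).+1 = i + 2 * j.+2)%N; last by lia.
by rewrite opprD.
Qed.

(* The series 1 + w z^2 / (1 - u z). *)
Definition euler_factor (z : R) : fps2 R :=
  fun i j => z ^+ (i + 2 * j) *+ (if j is j'.+1 then j' == 0%N else i == 0%N).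

(* This is \sum_(n >= 1) c n (u^n - p n), as p n is homogeneous of weight n. *)
Definition power_defect_series (c : nat -> R) : fps2 R :=
  fun i j => c (i + 2 * j)%N * power_defect i j.

Lemma euler_factorM z f i j : (euler_factor z * f) i j =
  f i j + (if j is j'.+1 then
    \sum_(b < i.+1) z ^+ (b + 2) * f (i - b)%N j' else 0).
Proof.
rewrite fps2_mulE exchange_big /= big_ord_recl /=.
congr (_ + _).
  rewrite big_ord_recl /= big1 ?addr0 => [|b _].
    by rewrite /euler_factor /= mulr1n expr0 mul1r !subn0.
  by rewrite /euler_factor /= mulr0n mul0r.
case: j => [|j]; first by rewrite big_ord0.
rewrite big_ord_recl /= [X in _ + X]big1 ?addr0 => [|c _].
  apply: eq_bigr => b _; rewrite /euler_factor /= mulr1n muln1 subSS subn0 //.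
by rewrite big1 // => b _; rewrite /euler_factor /= mulr0n mul0r.
Qed.

(** Compared by powers of $w$: both sides vanish at $w^0$, [power_defect1] settles $w^1$, and from
    $w^2$ on the left side is 0 and [power_defectSS] cancels the two contributions on the right. *)
Lemma euler_factor_deriv z :
  fps2_deriv (euler_factor z) =
  euler_factor z * power_defect_series (fun n => z ^+ n).
Proof.
apply/funext => i; apply/funext => j; rewrite euler_factorM.
rewrite /fps2_deriv /euler_factor /power_defect_series.
case: j => [|j].
  rewrite power_defect_0 mulr0 addr0; case: i => [|i]; first by rewrite mul0r.
  by rewrite mulr0n mulr0.
under eq_bigr => b _.
  rewrite mulrA -exprD (_ : b + 2 + _ = i + 2 * j.+1)%N; last first.
    by have := ltn_ord b; lia.
  over.
rewrite -mulr_sumr -mulrDr.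
rewrite (reindex_inj rev_ord_inj) /=.
under eq_bigr => b _ do rewrite subSS subKn ?leq_ord //.
case: j => [|j].
  rewrite big1 => [|b _]; last exact: power_defect_0.
  by rewrite addr0 power_defect1 muln1 mulrC.
by rewrite mulr0n mulr0 power_defectSS addNr mulr0.
Qed.

End PowerSums.

(** * Truncated sums and their convergence to [t] *)

Section TruncatedSums.
Variables (R : realType) (N a : nat).
Implicit Types (M n : nat) (k m : seq nat).

(* The reciprocal of M + 1, replaced by 0 outside the residue class of a. *)
Definition class_inv M : R := M.+1%:R^-1 *+ (M.+1 == a %[mod N])%N.

(* The part of the series t N a k with all summation indices at most M. *)
Fixpoint t_trunc M k : R :=
  if M is M'.+1 then
    t_trunc M' k +
    (if k is k1 :: k' then class_inv M' ^+ k1 * t_trunc M' k' else 0)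
  else (k == [::])%:R.

Definition t_box M n : set (seq nat) :=
  [set m | t_domain N a n m /\ all (geq M) m].

Definition monomial k m : R := \prod_(p <- zip m k) (p.1%:R ^- p.2).

Lemma t_trunc_nil M : t_trunc M [::] = 1.
Proof. by elim: M => //= M ->; rewrite addr0. Qed.

Lemma t_box_nil M : t_box M 0 = [set [::]].
Proof. by apply/seteqP; split=> [[|x m] [[]]|_ ->]. Qed.

Lemma t_box0 n : t_box 0 n.+1 = set0.
Proof.
by apply/seteqP; split=> // -[|x m] [[//= _ _]]; case: x.
Qed.

(** Case split on the largest entry: it is at most [M], or it is [M.+1] and the rest is at most [M].
    This matches the recursion of [t_trunc]. *)
Lemma t_boxS M n : t_box M.+1 n.+1 = t_box M n.+1 `|`
  (if (M.+1 == a %[mod N])%N then cons M.+1 @` t_box M n else set0).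
Proof.
have gtn_trans : transitive gtn by move=> y x z /= yx zy; exact: ltn_trans yx.
apply/seteqP; split=> [[|x m] [[]//= [sz]]|m].
  rewrite (path_sortedE gtn_trans) => /andP[mx sm] /andP[x1 m1] /andP[xa ma].
  move=> /andP[xM mM].
  have [lexM|ltMx] := leqP x M.
    left; split.
      by split; rewrite /= ?sz ?x1 ?xa ?(path_sortedE gtn_trans) ?mx.
    rewrite /= lexM /=; apply/allP => y /(allP mx) /= yx.
    exact: leq_trans (ltnW yx) lexM.
  have xE : x = M.+1 by apply/eqP; rewrite eqn_leq xM ltMx.
  right; rewrite -xE xa; exists m => //; split=> //.
  by apply/allP => y /(allP mx); rewrite xE.
case=> [[dm mM]|].
  by split=> //; apply/allP => y /(allP mM) /= /leqW.
case: ifPn => // Ma [m' [[sz sm m1 ma] mM] <-].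
have mM' : all (gtn M.+1) m' by apply/allP => y /(allP mM).
split; first by split; rewrite /= ?sz ?Ma ?(path_sortedE gtn_trans) ?mM'.
by rewrite /= leqnn; apply/allP => y /(allP mM) /= /leqW.
Qed.

Lemma finite_t_box M n : finite_set (t_box M n).
Proof.
elim: M n => [|M IH] [|n]; rewrite ?t_box_nil ?t_box0 //.
rewrite t_boxS finite_setU; split=> //.
by case: ifP => // _; exact: finite_image.
Qed.

Lemma sum_t_box M k : is_index k ->
  \sum_(m \in t_box M (size k)) monomial k m = t_trunc M k.
Proof.
have sum_nil M' : \sum_(m \in t_box M' 0) monomial [::] m = 1.
  by rewrite t_box_nil fsbig_set1 /monomial big_nil.
elim: M k => [|M IH] [|k1 k] ik; rewrite ?sum_nil ?t_trunc_nil //.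
  by rewrite t_box0 fsbig_set0.
have /andP[k1_gt0 ik'] : (0 < k1)%N && is_index k := ik.
rewrite [size _]/= t_boxS fsbigU0.
- rewrite (IH (k1 :: k)) //=; congr (_ + _); rewrite /class_inv.
  (* Outside the residue class the new term has the factor $0^{k_1}$, which is 0 since $k_1>0$. *)
  case: ifP => _; last by rewrite fsbig_set0 expr0n eqn0Ngt k1_gt0 mul0r.
  rewrite fsbig_image; last by move=> x y _ _ [].
  rewrite -(IH k) // mulr_fsumr; apply: eq_fsbigr => m _.
  by rewrite /monomial /= big_cons mulr1n exprVn.
- exact: finite_t_box.
- by case: ifP => // _; apply: finite_image; exact: finite_t_box.
- move=> m [[_ mM]]; case: ifP => // _ [m' _ mE].
  by move: mM; rewrite -mE /= ltnn.
Qed.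

Lemma class_inv_ge0 M : 0 <= class_inv M.
Proof. by rewrite mulrn_wge0 // invr_ge0. Qed.

Lemma t_trunc_ge0 M k : 0 <= t_trunc M k.
Proof.
elim: M k => [|M IH] k /=; first by case: eqP.
rewrite addr_ge0 //; case: k => // k1 k.
by rewrite mulr_ge0 // exprn_ge0 // class_inv_ge0.
Qed.

Lemma nondecreasing_t_trunc k : nondecreasing_seq (t_trunc ^~ k).
Proof.
apply/nondecreasing_seqP => M /=; rewrite lerDl; case: k => // k1 k.
by rewrite mulr_ge0 ?t_trunc_ge0 // exprn_ge0 // class_inv_ge0.
Qed.

(** Telescoping majorant: $2/(M+1)-2/(M+2)=2/((M+1)(M+2))\ge 1/(M+1)^2$. *)
Lemma class_inv_expr_le M n : (2 <= n)%N ->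
  class_inv M ^+ n <= 2 / M.+1%:R - 2 / M.+2%:R.
Proof.
move=> len.
have M0 : 0 <= M%:R :> R by [].
have invM : class_inv M <= M.+1%:R^-1.
  by rewrite /class_inv; case: eqP => _; rewrite ?mulr1n ?mulr0n.
have invM1 : M.+1%:R^-1 <= 1 :> R by rewrite invf_le1 // ler1n.
apply: (@le_trans _ _ (M.+1%:R^-1 ^+ 2)).
  apply: (@le_trans _ _ (class_inv M ^+ 2)).
    by apply: ler_wiXn2l len; rewrite ?class_inv_ge0 // (le_trans invM).
  by apply: lerXn2r => //; rewrite nnegrE ?class_inv_ge0.
rewrite -subr_ge0.
have -> : 2 / M.+1%:R - 2 / M.+2%:R - M.+1%:R^-1 ^+ 2 =
    M%:R / (M.+1%:R ^+ 2 * M.+2%:R) :> R.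
  have M1 : (M%:R + 1) != 0 :> R by rewrite natr1 pnatr_eq0.
  have M2 : (M%:R + 2) != 0 :> R by rewrite -natrD addn2 pnatr_eq0.
  rewrite -[M.+2]addn2 -[M.+1]addn1 !natrD; by field; rewrite M1 M2.
by rewrite divr_ge0 // mulr_ge0 // exprn_ge0.
Qed.

Lemma t_trunc_le M k : all (leq 2) k -> t_trunc M k <= 2 ^+ size k.
Proof.
elim: k M => [|k1 k IH] M; first by rewrite t_trunc_nil.
move=> /andP[k1_gt1 /IH {}IH].
have ge0 : 0 <= 2 ^+ size k :> R by rewrite exprn_ge0.
(* The sharper factor $2-2/(M+1)$ lets the induction on [M] telescope, and it vanishes at [M = 0],
   as the sum does. *)
suff : t_trunc M (k1 :: k) <= (2 - 2 / M.+1%:R) * 2 ^+ size k.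
  move=> /le_trans; apply; rewrite exprS ler_wpM2r //.
  by rewrite gerBl divr_ge0.
elim: M => [|M IHM] /=; first by rewrite divr1 subrr mul0r.
apply: (le_trans (lerD IHM
  (ler_pM _ _ (class_inv_expr_le M k1_gt1) (IH M)))).
- by rewrite exprn_ge0 // class_inv_ge0.
- exact: t_trunc_ge0.
- by rewrite -mulrDl ler_wpM2r // addrA subrK.
Qed.

(** The boxes are finite, and every finite part of the domain lies in one of them. *)
Lemma esum_t_trunc k : is_index k ->
  (\esum_(m in t_domain N a (size k)) (monomial k m)%:E =
   ereal_sup (range (fun M => (t_trunc M k)%:E)))%E.
Proof.
move=> ik; apply/eqP; rewrite eq_le; apply/andP; split.
  apply: ge_ereal_sup => _ [X [finX Xdom] <-].
  (* The largest entry sum over [X] bounds every entry of every list in [X]. *)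
  pose M := (\max_(m <- finmap.enum_fset (fset_set X)) sumn m)%N.
  have XM : X `<=` t_box M (size k).
    move=> m Xm; split; first exact: Xdom.
    apply/allP => y ym /=; apply: (@leq_trans (sumn m)).
      by rewrite sumnE (big_rem y) //= leq_addr.
    by apply: leq_bigmax_seq => //; rewrite in_fset_set // inE.
  apply: (@le_trans _ _ (t_trunc M k)%:E); last first.
    by apply: ereal_sup_ubound; exists M.
  rewrite -sum_t_box // -fsumEFin; last exact: finite_t_box.
  apply: lee_fsum_nneg_subset => //; first exact: finite_t_box.
    by move=> m; rewrite !inE => /XM.
  move=> m _; rewrite lee_fin; apply: prodr_ge0 => q _.
  by rewrite invr_ge0 exprn_ge0.
apply: ge_ereal_sup => _ [M _ <-]; apply: esum_ge.
exists (t_box M (size k)); first by split; [exact: finite_t_box|move=> m []].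
by rewrite fsumEFin ?sum_t_box //; exact: finite_t_box.
Qed.

(** Monotone convergence; the bound [t_trunc_le] makes the supremum finite, so that [fine] returns
    it instead of its default. *)
Lemma cvg_t_trunc k : all (leq 2) k ->
  t_trunc M k @[M --> \oo] --> t R N a k.
Proof.
move=> k2; have ik : is_index k.
  by apply/allP => x /(allP k2) /ltnW.
have supE := esum_t_trunc ik.
have cvgE : (t_trunc M k)%:E @[M --> \oo] -->
    ereal_sup (range (fun M => (t_trunc M k)%:E)).
  apply: ereal_nondecreasing_cvgn => x y xy; rewrite lee_fin.
  exact: nondecreasing_t_trunc.
have sup_fin : ereal_sup (range (fun M => (t_trunc M k)%:E)) \is a fin_num.
  rewrite ge0_fin_numE.
    apply: (@le_lt_trans _ _ (2 ^+ size k)%:E); last exact: ltry.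
    by apply: ge_ereal_sup => _ [M _ <-]; rewrite lee_fin t_trunc_le.
  apply: (@le_trans _ _ (t_trunc 0 k)%:E).
    by rewrite lee_fin t_trunc_ge0.
  by apply: ereal_sup_ubound; exists 0%N.
rewrite /t supE; rewrite -(fineK sup_fin) in cvgE.
exact: (fine_cvg cvgE).
Qed.

End TruncatedSums.

(** * The Euler product, its logarithmic derivative and the limit *)

Section GeneratingFunction.
Variables (R : realType) (N a : nat) (p : nat -> {poly {poly R}}).
Hypothesis hp : forall n, expresses_power_sum n (p n).

(* The indices of depth and height j and weight i + 2 j. *)
Fixpoint full_height (i j : nat) : seq (seq nat) :=
  if j is j'.+1 then
    [seq (b + 2)%N :: x | b <- iota 0 i.+1, x <- full_height (i - b) j']
  else if i is 0 then [:: [::]] else [::].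

Lemma full_heightS i j : full_height i j.+1 =
  [seq (b + 2)%N :: x | b <- iota 0 i.+1, x <- full_height (i - b) j].
Proof. by []. Qed.

Lemma mem_full_height i j x : x \in full_height i j =
  [&& size x == j, all (leq 2) x & sumn x == i + 2 * j]%N.
Proof.
elim: j i x => [|j IH] i x.
  by rewrite muln0 addn0; case: i x => [|i] [|y x] //; rewrite inE.
rewrite full_heightS; apply/allpairsPdep/idP => [[b [y []]]|].
  rewrite mem_iota add0n ltnS => /andP[_ bi].
  rewrite IH => /and3P[/eqP sy y2 /eqP wy] -> /=.
  by rewrite sy y2 wy eqxx addn2 /=; apply/eqP; lia.
case: x => // b x /and3P[sx /andP[b2]].
rewrite -/(all _ _) => x2 /eqP wx; rewrite /= in sx wx.
(* The entries after the first take at least $2j$ of the weight, hence $b-2\le i$ and [i - (b - 2)]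
   is not truncated. *)
have wx2 : (2 * j <= sumn x)%N.
  move: sx; rewrite eqSS => /eqP <-.
  by elim: (x) x2 => //= y x' IHx /andP[y2 /IHx]; lia.
exists (b - 2)%N, x; rewrite mem_iota IH x2.
split; [|apply/and3P; split=> //; apply/eqP|congr cons]; lia.
Qed.

Lemma full_height_uniq i j : uniq (full_height i j).
Proof.
elim: j i => [|j IH] i; first by case: i.
rewrite full_heightS.
apply: allpairs_uniq_dep => [|b _|]; [exact: iota_uniq|exact: IH|].
by move=> [b x] [b' x'] _ _ /= [/eqP]; rewrite eqn_add2r => /eqP -> ->.
Qed.

(** Height equals depth exactly when all entries are at least 2. Positivity of [j] excludes the
    empty index, which is not admissible. *)
Lemma full_height_I0 i j : (0 < j)%N ->
  I0 (i + 2 * j) j j = [set` full_height i j].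
Proof.
move=> j0; apply/seteqP; split=> x /=; rewrite mem_full_height.
  case=> _ wx sx hx; apply/and3P; split; [exact/eqP| |exact/eqP].
  by rewrite all_count; apply/eqP; exact: etrans hx (esym sx).
case/and3P=> /eqP sx x2 /eqP wx; split=> //.
  rewrite /admissible; apply/andP; split.
    by apply/allP => y /(allP x2) /ltnW.
  case: x sx x2 {wx} => [|y x] /=; last by move=> _ /andP[].
  by move=> sz; move: j0; rewrite -sz.
by rewrite -sx; apply/eqP; rewrite -all_count.
Qed.

Lemma sum_full_heightS (F : seq nat -> R) i j :
  \sum_(x <- full_height i j.+1) F x =
  \sum_(b < i.+1) \sum_(x <- full_height (i - b) j) F (b + 2 :: x)%N.
Proof.
rewrite full_heightS big_allpairs_dep -[iota 0 _]/(index_iota 0 i.+1).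
by rewrite big_mkord.
Qed.

Definition euler_prod M : fps2 R :=
  \prod_(m < M) euler_factor (class_inv R N a m).

(** Induction on the number of factors: in the last one, choosing 1 leaves $m_1\le M$, and choosing
    $z^{b+2}u^bw$ puts $m_1=M+1$ with exponent $b+2$. *)
Lemma euler_prodE M i j :
  euler_prod M i j = \sum_(x <- full_height i j) t_trunc R N a M x.
Proof.
elim: M i j => [|M IH] i j; rewrite /euler_prod.
  rewrite big_ord0 fps2_oneE.
  case: j => [|j]; last first.
    rewrite andbF sum_full_heightS big1 // => b _.
    by rewrite big1.
  by case: i => [|i]; rewrite /= ?big_nil // big_seq1.
rewrite big_ord_recr /= mulrC euler_factorM -/(euler_prod M) /=.
rewrite big_split /= -IH; congr (_ + _).
case: j => [|j].
  by case: i => [|i]; rewrite /= ?big_nil // big_seq1.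
rewrite sum_full_heightS; apply: eq_bigr => b _.
by rewrite IH mulr_sumr.
Qed.

(** The logarithmic derivative is additive over the factors, and the $n$-th powers of the
    [class_inv] values add up to [t_trunc M [:: n]]. *)
Lemma euler_prod_deriv M : fps2_deriv (euler_prod M) =
  euler_prod M * power_defect_series p (fun n => t_trunc R N a M [:: n]).
Proof.
elim: M => [|M IH].
  rewrite /euler_prod big_ord0 fps2_deriv1 mul1r.
  by apply/funext => i; apply/funext => j; rewrite /power_defect_series mul0r.
rewrite /euler_prod big_ord_recr /= -/(euler_prod M).
rewrite fps2_derivM IH (euler_factor_deriv hp).
rewrite (_ : power_defect_series p (fun n => t_trunc R N a M [:: n] + _) =
  power_defect_series p (fun n => t_trunc R N a M [:: n]) +
  power_defect_series p (fun n => class_inv R N a M ^+ n)).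
  by ring.
apply/funext => i; apply/funext => j.
by rewrite fps2_addE /power_defect_series t_trunc_nil mulr1 mulrDl.
Qed.

Definition t_series : fps2 R :=
  fun i j => \sum_(x <- full_height i j) t R N a x.

Lemma cvg_sum_seq (I : eqType) (r : seq I) (F : I -> nat -> R) (l : I -> R) :
  (forall x, x \in r -> F x M @[M --> \oo] --> l x) ->
  \sum_(x <- r) F x M @[M --> \oo] --> \sum_(x <- r) l x.
Proof.
elim: r => [|x r IH] Fl.
  by rewrite big_nil; under eq_fun do rewrite big_nil; exact: cvg_cst.
rewrite big_cons; under eq_fun do rewrite big_cons.
apply: cvgD; first by apply: Fl; rewrite mem_head.
by apply: IH => y yr; apply: Fl; rewrite inE yr orbT.
Qed.

Lemma cvg_euler_prod i j : euler_prod M i j @[M --> \oo] --> t_series i j.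
Proof.
under eq_fun do rewrite euler_prodE.
apply: cvg_sum_seq => x; rewrite mem_full_height => /and3P[_ x2 _].
exact: cvg_t_trunc.
Qed.

Lemma cvg_power_defect_series i j :
  power_defect_series p (fun n => t_trunc R N a M [:: n]) i j @[M --> \oo] -->
  power_defect_series p (fun n => t R N a [:: n]) i j.
Proof.
rewrite /power_defect_series; case: j => [|j].
  (* At $j=0$ the sums [t_trunc M [:: 1]] may diverge, but their coefficient is 0. For $j\ge1$ the
     exponent is at least 2. *)
  rewrite power_defect_0 // mulr0.
  by under eq_fun do rewrite mulr0; exact: cvg_cst.
apply: cvgMr_tmp; apply: cvg_t_trunc; rewrite /= andbT; lia.
Qed.

(** The limit of [euler_prod_deriv], taken coefficientwise: each coefficient of a product is a
    finite sum. *)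
Lemma t_series_deriv : fps2_deriv t_series =
  t_series * power_defect_series p (fun n => t R N a [:: n]).
Proof.
apply/funext => i; apply/funext => j.
apply: (@cvg_unique _ _ (fps2_deriv (euler_prod M) i j @[M --> \oo])) => //=.
  by apply: cvgMl_tmp; exact: cvg_euler_prod.
under eq_fun do rewrite euler_prod_deriv fps2_mulE.
rewrite fps2_mulE; apply: cvg_sum_seq => b _; apply: cvg_sum_seq => c _.
by apply: cvgM; [exact: cvg_euler_prod|exact: cvg_power_defect_series].
Qed.

Lemma t_nil : t R N a [::] = 1.
Proof.
apply: (@cvg_unique _ _ (t_trunc R N a M [::] @[M --> \oo])) => //=.
  exact: cvg_t_trunc.
by under eq_fun do rewrite t_trunc_nil; exact: cvg_cst.
Qed.

End GeneratingFunction.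

(** * Both sides as solutions of one differential equation *)

Theorem corollary2p9 (R : realType) (N a : nat)
    (hN : (0 < N)%N) (ha : (1 <= a <= N)%N)
    (p : nat -> {poly {poly R}})
    (hp : forall n, expresses_power_sum n (p n)) :
  fps2_add (fps2_one R)
    (fps2_sum [set kn : nat * nat | (2 * kn.2 <= kn.1)%N /\ (1 <= kn.2)%N]
       (fun kn => fps2_scale (G0 R N a kn.1 kn.2 kn.2)
          (fps2_of_poly (poly_u ^+ (kn.1 - 2 * kn.2) * poly_w ^+ kn.2))))
  = fps2_exp
      (fps2_sum [set n : nat | (2 <= n)%N]
         (fun n => fps2_scale (t R N a [:: n] / n%:R)
            (fps2_of_poly (poly_u ^+ n - p n)))).
Proof.
set f := fps2_sum [set n : nat | (2 <= n)%N] _.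
have coef_uw (r s i j : nat) :
    (poly_u ^+ r * poly_w ^+ s : {poly {poly R}})`_j`_i =
    ((i == r) && (j == s))%:R.
  rewrite /poly_u -polyC_exp coefCM /poly_w coefXn.
  by case: (j == s); rewrite ?mulr1 ?mulr0 ?coef0 ?andbF // coefXn andbT.
set g := fps2_add (fps2_one R) _.
have -> : g = t_series R N a.
  apply/funext => i; apply/funext => j.
  rewrite /g /fps2_add /fps2_sum /fps2_scale.
  rewrite -[fps2_one R]/(1 : fps2 R) fps2_oneE /fps2_of_poly.
  case: j => [|j].
    rewrite fsbig1 => [|[k n] [/= _ n0]]; last first.
      by rewrite coef_uw; case: n n0 => // n _; rewrite andbF mulr0.
    rewrite addr0 andbT /t_series /=.
    by case: i => [|i]; rewrite ?big_nil // big_seq1 t_nil.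
  rewrite andbF add0r.
  (* Only $(k,n)=(i+2(j+1),j+1)$ contributes to $u^iw^{j+1}$. *)
  rewrite -(@fsbig_widen _ _ _ _ [set (i + 2 * j.+1, j.+1)%N]) => [|kn ->|].
  - rewrite fsbig_set1 /= coef_uw addnK !eqxx mulr1 /G0.
    by rewrite full_height_I0 // -fsbig_seq ?full_height_uniq.
  - by split=> //=; exact: leq_addl.
  - move=> [k n] [[/= le_k _] /= ne]; rewrite coef_uw.
    case: eqP => [ik|]; last by rewrite mulr0.
    case: eqP => [jn|]; last by rewrite mulr0.
    by case: ne; congr pair; lia.
have defect_neq n i j : (i + 2 * j)%N != n -> (poly_u ^+ n - p n)`_j`_i = 0.
  move=> ne; rewrite !coefB (coef_power_sum_neq hp) // subr0.
  rewrite -[poly_u ^+ n]mulr1 -(expr0 poly_w) coef_uw.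
  case: eqP => // iE; case: eqP => // jE.
  by move: ne; rewrite iE jE muln0 addn0 eqxx.
have fE i j : f i j =
    t R N a [:: i + 2 * j]%N / (i + 2 * j)%:R * power_defect p i j.
  rewrite /f /fps2_sum /fps2_scale /fps2_of_poly.
  have [le2|lt2] := leqP 2 (i + 2 * j)%N.
    rewrite -(@fsbig_widen _ _ _ _ [set (i + 2 * j)%N]) => [|n -> //|].
      by rewrite fsbig_set1 /power_defect (ltnW le2).
    by move=> n [_ /eqP ne] /=; rewrite defect_neq ?mulr0 // eq_sym.
  (* Weights 0 and 1, absent from the sum over $n\ge2$, force $j=0$, where [power_defect] vanishes
     too. *)
  have j0 : j = 0%N by lia.
  rewrite j0 power_defect_0 // mulr0 fsbig1 // => n /= n2.
  by rewrite -j0 defect_neq ?mulr0 //; lia.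
have f0 i : f i 0%N = 0 by rewrite fE power_defect_0 // mulr0.
have df : fps2_deriv f = power_defect_series p (fun n => t R N a [:: n]).
  apply/funext => i; apply/funext => j.
  rewrite /fps2_deriv fE /power_defect_series.
  (* The weight cancels against the denominator in [fE] unless it is 0; there [power_defect] is
     0. *)
  have [ij|ij] := eqVneq (i + 2 * j)%N 0%N.
    have [-> ->] : i = 0%N /\ j = 0%N by lia.
    by rewrite power_defect_0 // !mulr0.
  by rewrite mulrA mulrCA divff ?mulr1 // pnatr_eq0.
apply: (@fps2_deriv_uniq _ _ _
  (power_defect_series p (fun n => t R N a [:: n]))).
- exact: t_series_deriv.
- by rewrite -df; exact: fps2_deriv_exp.
- by rewrite /power_defect_series power_defect_0 // mulr0.
- rewrite (@fps2_expE _ _ 1) // /fps2_exp_trunc fps2_sumE big_ord1.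
  rewrite /fps2_scale expr0 fps2_oneE /= invr1 mul1r.
  by rewrite /t_series /= big_seq1 t_nil.
Qed.
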